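(* Let $G$ be a finite group of order $n$. Then $G$ is second maximal, i.e. $\psi(G)=\frac{7}{11}\psi(C_n)$, if and only if $n=4k$ for some positive integer $k$ with $(k,2)=1$ and $G\cong (C_2\times C_2)\times C_k$.
   Context: All groups are finite. For a finite group $G$, $\psi(G)=\sum_{x\in G} o(x)$, where $o(x)$ denotes the order of the element $x$. $C_m$ denotes the cyclic group of order $m$. $(a,b)$ denotes the greatest common divisor of the integers $a,b$. A group $G$ of order $n$ is called second maximal if $\psi(G)=\frac{7}{11}\psi(C_n)$. *)

(* Defs.v *)
From mathcomp Require Import all_boot all_order all_algebra all_fingroup all_solvable.

Set Implicit Arguments.
Unset Strict Implicit.
Unset Printing Implicit Defensive.

Import GroupScope GRing.Theory.

Definition psi (gT : finGroupType) (G : {group gT}) : nat :=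
  (\sum_(x in G) #[x])%N.

(* [Zp m] is a subgroup of ['Z_m] of order exactly [m] for every [m > 0]; it is
   trivial for [m = 1], whereas the type ['Z_1] has two elements. *)
Definition C (m : nat) : {group 'Z_m} := [group of Zp m].

Definition second_maximal (gT : finGroupType) (G : {group gT}) : Prop :=
  ((psi G)%:R = 7%:R / 11%:R * (psi (C #|G|))%:R :> rat)%R.

(* Main.v *)
Require Import Defs.
From mathcomp Require Import all_boot all_order all_algebra all_fingroup all_solvable.
From mathcomp Require Import zify.

Set Implicit Arguments.
Unset Strict Implicit.
Unset Printing Implicit Defensive.
Import GroupScope.

(** Write psi(n) for the sum of the element orders of the cyclic group of order
    n.  The inequality 11 psi(G) < 7 psi(n) holds for every group G of order n
    that is neither cyclic nor a product V x K with V a Klein four-group and K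
    cyclic of odd order ([psi_large_cyclic_or_klein]).  For such a product,
    psi(G) = 7 psi(k) and psi(4 k) = 11 psi(k), so the ratio is exactly 7/11; for
    a cyclic group the ratio is 1.

    The inequality is proved by strong induction on n; suppose that
    n > 1 and 11 psi(G) >= 7 psi(n), and let q be the largest prime divisor of n.  Since
    psi(p^a) >= p^(2a) p/(p+1), a telescoping product over the primes up to q
    gives psi(n) >= 2 n^2 / (q+1) ([psi_C_lower_bound]).  Some element of G has at
    least the average order, so psi(G) large forces an element x whose cyclic
    subgroup has small index.  For q = 2 the index is at most 2 and the value of
    psi on cyclic 2-groups leaves only |G| = 4 ([two_group_psi_large]).  For q > 2
    the index is less than q ([psi_large_small_index]), so <x> contains a Sylow
    q-subgroup P of G; its number of conjugates is at most that index and is 1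
    mod q, so P is normal as well as cyclic ([small_index_normal_Sylow]).

    By Schur-Zassenhaus G = P ><| H.  An element of H either centralises P or acts
    on it without nontrivial fixed points, and this determines the orders in each
    coset of P: with Z the centraliser of P in H, the identity
    psi(G) = psi(P) psi(Z) + |P| (psi(H) - psi(Z)) holds ([psi_sdprod]).  If Z = H,
    then psi(G) = psi(P) psi(H), the induction hypothesis applies to H, and the
    factor P is absorbed in the cyclic part.  If Z < H, then
    psi(G) < psi(P) psi(H), and H is either of Klein type, where this already
    contradicts 11 psi(H) = 7 psi(|H|), or cyclic, where 3 psi(Z) <= psi(H) and
    7 |P| <= 3 psi(P) give the ratio at most 1/3 + 2/7 = 13/21 < 7/11. *)

(** * Element-order sums and cyclic groups *)

Lemma psi_isog (aT rT : finGroupType) (G : {group aT}) (H : {group rT}) :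
  G \isog H -> psi G = psi H.
Proof.
case/isogP=> f injf fG; rewrite /psi -fG morphimEdom big_imset; last exact/injmP.
by apply: eq_bigr => x Gx; rewrite order_injm.
Qed.

Lemma psi_cyclic (gT : finGroupType) (G : {group gT}) :
  cyclic G -> psi G = psi (C #|G|).
Proof.
case/cyclicP=> x defG; rewrite defG; apply/esym/psi_isog.
by have := Zp_isog x; rewrite orderE -defG.
Qed.

Lemma card_C n : (0 < n)%N -> #|C n| = n.
Proof. exact: card_Zp. Qed.

Lemma cyclic_C n : cyclic (C n).
Proof.
rewrite /C /= /Zp; case: ifP => [n_gt1|_]; last exact: cyclic1.
by apply/cyclicP; exists Zp1; exact: Zp_cycle.
Qed.

Lemma cardG_le_psi (gT : finGroupType) (G : {group gT}) : (#|G| <= psi G)%N.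
Proof. by rewrite -sum1_card /psi; apply: leq_sum => x _; apply: order_gt0. Qed.

Lemma psi_setD (gT : finGroupType) (G H : {group gT}) :
  H \subset G -> psi G = (psi H + \sum_(x in G :\: H) #[x])%N.
Proof. by move=> sHG; rewrite {1}/psi (big_setID H) (setIidPr sHG). Qed.

Lemma psi_proper (gT : finGroupType) (G H : {group gT}) :
  H \proper G -> (psi H < psi G)%N.
Proof.
case/properP=> sHG [x Gx nHx].
rewrite (psi_setD sHG) -[X in (X < _)%N]addn0 ltn_add2l.
by rewrite (bigD1 x) ?ltn_addr ?order_gt0 // !inE nHx.
Qed.

(** * Element-order sums of semidirect products *)

Lemma sum_sdprod (gT : finGroupType) (G K H : {group gT}) (F : gT -> nat) :
  K ><| H = G -> (\sum_(x in G) F x = \sum_(h in H) \sum_(x in K :* h) F x)%N.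
Proof.
case/sdprodP=> _ defG _ tiKH.
rewrite (partition_big (remgr K H) [in H]) => [|x Gx]; last first.
  by rewrite mem_remgr // defG.
apply: eq_bigr => h Hh; apply: eq_bigl => x; apply/andP/rcosetP.
  case; rewrite -defG => KHx /eqP defh; exists (divgr K H x).
    exact: mem_divgr.
  by rewrite -defh; apply: divgr_eq.
case=> k Kk ->; split; first by rewrite -defG mem_mulg.
by rewrite remgrMid.
Qed.

(** If [h] centralises [K] then orders multiply along the coset [K :* h]; for the
    opposite extreme see [sum_rcoset_order_free]. *)
Lemma sum_rcoset_order_cent (gT : finGroupType) (K : {group gT}) (h : gT) :
  h \in 'C(K) -> coprime #|K| #[h] ->
  (\sum_(x in K :* h) #[x] = psi K * #[h])%N.
Proof.
move=> cKh coKh; rewrite -rcosetE /rcoset big_imset; last exact: in2W (mulIg h).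
rewrite /psi big_distrl; apply: eq_bigr => k Kk /=.
rewrite orderM //; first by apply/esym; exact: (centP cKh).
exact: coprime_dvdl (order_dvdG Kk) coKh.
Qed.

Lemma psi_dprod (gT : finGroupType) (G A B : {group gT}) :
  A \x B = G -> coprime #|A| #|B| -> psi G = (psi A * psi B)%N.
Proof.
move=> defG coAB; have [_ _ cAB _] := dprodP defG.
rewrite dprodEsd // in defG.
rewrite [psi G](sum_sdprod _ defG) [psi B]/psi big_distrr.
apply: eq_bigr => b Bb; apply: sum_rcoset_order_cent.
  exact: (subsetP cAB).
exact: coprime_dvdr (order_dvdG Bb) coAB.
Qed.

Lemma cyclic_pgroup_chain (gT : finGroupType) (p : nat) (P X Y : {group gT}) :
  p.-group P -> cyclic P -> X \subset P -> Y \subset P ->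
  (X \subset Y) || (Y \subset X).
Proof.
move=> pP cycP sXP sYP.
rewrite -(cardSg_cyclic cycP sXP sYP) -(cardSg_cyclic cycP sYP sXP).
rewrite (card_pgroup (pgroupS sXP pP)) (card_pgroup (pgroupS sYP pP)).
case/orP: (leq_total (logn p #|X|) (logn p #|Y|)) => /(dvdn_exp2l p) -> //.
exact: orbT.
Qed.

(** Coprime action on an abelian group splits it as [P, h] times 'C_P[h], and a
    cyclic p-group has no two nontrivial subgroups that meet trivially: so an
    automorphism of order prime to p fixes everything or nothing but 1. *)
Lemma cent1_cyclic_coprime (gT : finGroupType) (p : nat) (P : {group gT}) (h : gT) :
  p.-group P -> cyclic P -> h \in 'N(P) -> coprime #|P| #[h] -> h \notin 'C(P) ->
  'C_P[h] = 1.
Proof.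
move=> pP cycP nPh coPh ncPh.
have nPA: <[h]> \subset 'N(P) by rewrite cycle_subG.
have := coprime_abel_cent_TI nPA coPh (cyclic_abelian cycP).
have sYP: [~: P, <[h]>] \subset P by rewrite commg_subl.
rewrite -cent_cycle.
case/orP: (cyclic_pgroup_chain pP cycP (subsetIl P 'C(<[h]>)) sYP) => /= sXY ti.
  by apply/trivgP; rewrite -ti subsetI sXY subsetIr.
case/negP: ncPh; rewrite -cycle_subG centsC; apply/commG1P/trivgP.
by rewrite -ti subsetI subxx (subset_trans sXY) ?subsetIr.
Qed.

(** The conjugates of [h] under [K] all lie in [K :* h], and there are [#|K|] of
    them when [h] has no fixed point: the whole coset is one conjugacy class, and
    all its elements have the order of [h]. *)
Lemma sum_rcoset_order_free (gT : finGroupType) (K : {group gT}) (h : gT) :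
  h \in 'N(K) -> 'C_K[h] = 1 -> (\sum_(x in K :* h) #[x] = #|K| * #[h])%N.
Proof.
move=> nKh tiK.
have sub: h ^: K \subset K :* h.
  apply/subsetP=> _ /imsetP[k Kk ->]; apply/rcosetP.
  exists (k^-1 * k ^ h^-1); first by rewrite groupM ?groupV // memJ_norm ?groupV.
  by rewrite !conjgE invgK !mulgA mulgKV.
have eqc: h ^: K = K :* h.
  by apply/eqP; rewrite eqEcard sub card_rcoset -index_cent1 tiK indexg1 /=.
rewrite -eqc (eq_bigr (fun=> #[h])) => [|_ /imsetP[k _ ->]]; last exact: orderJ.
by rewrite sum_nat_const -index_cent1 tiK indexg1.
Qed.

(** The cosets of [P] by elements of 'C_H(P) contribute [psi P] times the order,
    and the others [#|P|] times the order.  The subtraction in the resulting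
    formula is moved to the other side. *)
Lemma psi_sdprod (gT : finGroupType) (p : nat) (G P H : {group gT}) :
  P ><| H = G -> p.-group P -> cyclic P -> coprime #|P| #|H| ->
  (psi G + #|P| * psi 'C_H(P) = psi P * psi 'C_H(P) + #|P| * psi H)%N.
Proof.
move=> defG pP cycP coPH; have [_ _ nPH _] := sdprodP defG.
rewrite (psi_setD (subsetIl H 'C(P))) [psi G](sum_sdprod _ defG).
rewrite (big_setID 'C(P)) /= mulnDr setDIr setDv set0U.
have ->: (\sum_(h in H :&: 'C(P)) \sum_(x in P :* h) #[x] = psi P * psi 'C_H(P))%N.
  rewrite [psi 'C_H(P)]/psi big_distrr; apply: eq_bigr => h /setIP[Hh cPh].
  apply: sum_rcoset_order_cent => //.
  exact: coprime_dvdr (order_dvdG Hh) coPH.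
rewrite -addnA; congr (_ + _)%N; rewrite addnC; congr (_ + _)%N.
rewrite big_distrr; apply: eq_bigr => h /setDP[Hh ncPh].
apply: sum_rcoset_order_free; first exact: (subsetP nPH).
apply: (cent1_cyclic_coprime pP) => //; first exact: (subsetP nPH).
exact: coprime_dvdr (order_dvdG Hh) coPH.
Qed.

Lemma psi_sdprod_lt (gT : finGroupType) (p : nat) (G P H : {group gT}) :
  P ><| H = G -> p.-group P -> cyclic P -> coprime #|P| #|H| ->
  P :!=: 1 -> ~~ (H \subset 'C(P)) -> (psi G < psi P * psi H)%N.
Proof.
move=> defG pP cycP coPH ntP ncPH.
have psiG := psi_sdprod defG pP cycP coPH.
have ltZ : (psi 'C_H(P) < psi H)%N.
  by apply: psi_proper; rewrite properE subsetIl subsetI subxx.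
have ltP : (#|P| < psi P)%N.
  have [x Px nt_x] := trivgPn _ ntP.
  rewrite -sum1_card /psi (bigD1 x) // [X in (_ < X)%N](bigD1 x) //=.
  rewrite -addSn leq_add ?order_gt1 //.
  by apply: leq_sum => y _; apply: order_gt0.
move: psiG ltZ ltP; move: (psi G) (psi P) (psi 'C_H(P)) (psi H) #|P|.
move=> g p' z h n psiG ltZ ltP.
have : ((p' - n) * z < (p' - n) * h)%N by rewrite ltn_pmul2l // subn_gt0.
by rewrite !mulnBl; nia.
Qed.

(** * The function psi on cyclic groups *)

Lemma psi_C_mul a b : (0 < a)%N -> (0 < b)%N -> coprime a b ->
  psi (C (a * b)) = (psi (C a) * psi (C b))%N.
Proof.
move=> a_gt0 b_gt0 coab; have defX := setX_dprod (C a) (C b).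
have i1 := isog_setX1 [the finGroupType of 'Z_b] (C a).
have i2 := isog_set1X [the finGroupType of 'Z_a] (C b).
have co: coprime #|setX (C a) (1%G : {group 'Z_b})| #|setX (1%G : {group 'Z_a}) (C b)|.
  by rewrite -(card_isog i1) -(card_isog i2) !card_C.
have cyc: cyclic (setX (C a) (C b)).
  by rewrite (cyclic_dprod defX) -?(isog_cyclic i1) -?(isog_cyclic i2) ?cyclic_C.
rewrite (psi_isog i1) (psi_isog i2) -(psi_dprod defX co) (psi_cyclic cyc).
by rewrite cardsX !card_C.
Qed.

Lemma psi_C_gt0 n : (0 < psi (C n))%N.
Proof. exact: leq_trans (cardG_gt0 _) (cardG_le_psi _). Qed.

(** The elements outside the subgroup of index p are the generators. *)
Lemma psi_cyclic_pgroup (gT : finGroupType) (G : {group gT}) p :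
  prime p -> p.-group G -> cyclic G -> (p.+1 * psi G = p * #|G| ^ 2 + 1)%N.
Proof.
move=> pr_p /card_pgroup; have p_gt0 := prime_gt0 pr_p.
move: (logn _ _) => a; elim: a G => [|a IHa] G oG cycG.
  rewrite oG muln1 addn1 /psi.
  by rewrite (card1_trivg oG) big_set1 order1 muln1.
have [x defG] := cyclicP cycG.
have ox : #[x] = (p ^ a.+1)%N by rewrite orderE -defG.
have oZ : #|<[x ^+ p]>| = (p ^ a)%N.
  by rewrite -orderE orderXdiv ox expnS ?dvdn_mulr // mulKn.
have sZG : <[x ^+ p]> \subset G by rewrite defG cycle_subG mem_cycle.
have -> : psi G = (psi <[x ^+ p]> + (p ^ a.+1 - p ^ a) * p ^ a.+1)%N.
  rewrite (psi_setD sZG); congr (_ + _)%N.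
  rewrite (eq_bigr (fun=> p ^ a.+1)%N).
    by rewrite sum_nat_const cardsD (setIidPr sZG) oZ oG.
  move=> y /setDP[Gy nZy].
  have /(dvdn_pfactor _ _ pr_p)[b le_b oy] : #[y] %| p ^ a.+1.
    by rewrite -oG order_dvdG.
  move: le_b; rewrite leq_eqVlt ltnS => /orP[/eqP eq_b | le_b]; first by rewrite oy eq_b.
  case/negP: nZy; rewrite -cycle_subG -(cardSg_cyclic cycG) ?cycle_subG //.
    by rewrite -orderE oy oZ dvdn_exp2l.
  by rewrite defG mem_cycle.
rewrite mulnDr (IHa _ oZ (cycle_cyclic _)) oZ oG.
have le_p : (p ^ a <= p ^ a.+1)%N by rewrite leq_exp2l // prime_gt1.
rewrite expnS in le_p *.
move: (p ^ a)%N le_p => t le_p; rewrite mulnBl; nia.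
Qed.

(** Each prime power p^a exactly dividing n multiplies psi by at least
    p^(2a) p/(p+1), and the product of p/(p+1) over primes p in (c, q] is at least
    the telescoping product (c+1)/(q+1) over all integers of that interval.  The
    induction on [q] adds one factor of the latter at a time.  The bounds c = 1
    and c = 2 serve for arbitrary n and for odd n. *)
Lemma psi_C_lower_bound c q n : (c <= q)%N -> (0 < n)%N ->
  {in \pi(n), forall p, c < p <= q} ->
  (c.+1 * n ^ 2 <= q.+1 * psi (C n))%N.
Proof.
elim: q n => [|q IHq] n le_cq n_gt0 pi_n.
  have -> : n = 1%N.
    apply/eqP; rewrite eqn_leq n_gt0 andbT leqNgt -pi_pdiv; apply/negP => /pi_n.
    by case: (pdiv n) => // k; rewrite ltn0 andbF.
  by move: le_cq; rewrite leqn0 => /eqP->; rewrite leq_pmulr ?psi_C_gt0.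
move: le_cq; rewrite leq_eqVlt ltnS => /orP[/eqP eq_c | le_cq].
  have -> : n = 1%N.
    apply/eqP; rewrite eqn_leq n_gt0 andbT leqNgt -pi_pdiv; apply/negP => /pi_n.
    by rewrite eq_c ltnNge andNb.
  by rewrite -eq_c leq_mul2l psi_C_gt0.
have [pr_q | npr_q] := boolP (prime q.+1); last first.
  have le_q: (q.+1 * psi (C n) <= q.+2 * psi (C n))%N.
    by rewrite leq_mul2r leqnSn orbT.
  apply: leq_trans (IHq n le_cq n_gt0 _) le_q => p pi_p.
  have /andP[-> le_p] := pi_n p pi_p; rewrite -ltnS ltn_neqAle le_p andbT.
  by apply: contraNneq npr_q => <-; move: pi_p; rewrite mem_primes => /andP[].
have [m co_qm def_n] := pfactor_coprime pr_q n_gt0.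
set a := logn _ _ in def_n.
have m_gt0 : (0 < m)%N by move: n_gt0; rewrite def_n muln_gt0 => /andP[].
have qa_gt0 : (0 < q.+1 ^ a)%N by rewrite expn_gt0.
have IHm : (c.+1 * m ^ 2 <= q.+1 * psi (C m))%N.
  apply: IHq => // p pi_p; have := pi_n p.
  rewrite {1}def_n primesM // pi_p => /(_ isT) /andP[-> le_p].
  rewrite -ltnS ltn_neqAle le_p andbT.
  apply: contraTneq pi_p => ->; rewrite mem_primes !negb_and -prime_coprime //.
  by rewrite co_qm !orbT.
have oC := card_C qa_gt0.
have psi_q : (q.+2 * psi (C (q.+1 ^ a)) = q.+1 * (q.+1 ^ a) ^ 2 + 1)%N.
  rewrite -[in RHS]oC; apply: psi_cyclic_pgroup (cyclic_C _) => //.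
  by rewrite /pgroup oC pnatX pnat_id.
rewrite def_n psi_C_mul //; last by rewrite coprime_sym coprimeXl.
move: (psi (C m)) (psi (C (q.+1 ^ a))) IHm psi_q => u v.
move: (q.+1 ^ a)%N => t IHm psi_q.
have h1 : (q.+1 * t ^ 2 * (c.+1 * m ^ 2) <= (q.+2 * v) * (q.+1 * u))%N.
  by apply: leq_mul => //; rewrite psi_q leq_addr.
rewrite -(@leq_pmul2l q.+1) //; nia.
Qed.

(** All nontrivial elements have order at least 3, so psi(P) >= 3 |P| - 2; the
    bound is attained by the group of order 3. *)
Lemma psi_pgroup_lower_bound (gT : finGroupType) (p : nat) (P : {group gT}) :
  p.-group P -> (2 < p)%N -> P :!=: 1 -> (7 * #|P| <= 3 * psi P)%N.
Proof.
move=> pP p_gt2 ntP.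
have [pr_p p_dvd _] := pgroup_pdiv pP ntP.
have leP : (3 <= #|P|)%N by apply: leq_trans p_gt2 (dvdn_leq _ p_dvd).
have : (1 + (#|P| - 1) * 3 <= psi P)%N.
  rewrite (psi_setD (sub1G P)) /psi big_set1 order1 leq_add2l.
  have <- : #|P :\: 1| = (#|P| - 1)%N.
    by rewrite cardsD (setIidPr (sub1G P)) cards1.
  rewrite -sum_nat_const.
  apply: leq_sum => x /setD1P[nt_x Px].
  have [||_ p_dvdx _] := @pgroup_pdiv _ p <[x]>%G.
  - by apply: pgroupS pP; rewrite cycle_subG.
  - by rewrite cycle_eq1.
  by apply: leq_trans p_gt2 (dvdn_leq _ p_dvdx); rewrite order_gt0.
lia.
Qed.

(** For a suitable primary component [a] of a generator, one of those outside [Z],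
    translation by [a] at least doubles the order of every element of [Z]; so the
    coset of [a] alone contributes twice psi(Z). *)
Lemma psi_proper_cyclic_le (gT : finGroupType) (H Z : {group gT}) :
  cyclic H -> Z \proper H -> (3 * psi Z <= psi H)%N.
Proof.
move=> cycH /andP[sZH nsHZ].
have [x defH] := cyclicP cycH.
have Hx : x \in H by rewrite defH cycle_id.
have [p nZxp] : exists p : nat, x.`_p \notin Z.
  case: (pickP (fun p : 'I_#[x].+1 => x.`_(p : nat) \notin Z)) => [p ? | allZ].
    by exists p.
  case/negP: nsHZ; rewrite defH cycle_subG -(prod_constt x) big_mkord.
  by apply: group_prod => p _; apply: negbFE (allZ p).
set a := x.`_p in nZxp.
have Ha : a \in H by rewrite /a groupX.
have cHH := centsP (cyclic_abelian cycH).
have key z : z \in Z -> (2 * #[z] <= #[z * a])%N.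
  move=> Zz; have Hz := subsetP sZH z Zz.
  have czp : z.`_p \in Z by rewrite groupX.
  have Hzp := subsetP sZH _ czp.
  have czp' : z.`_p^' \in Z by rewrite groupX.
  have Hzp' := subsetP sZH _ czp'.
  have pza : p.-elt (z.`_p * a).
    by apply: p_eltM; rewrite ?p_elt_constt //; apply: cHH.
  have oz : #[z] = (#[z.`_p] * #[z.`_p^'])%N.
    by rewrite !order_constt partnC.
  have oza : #[z * a] = (#[z.`_p * a] * #[z.`_p^'])%N.
    rewrite -orderM.
    - congr #[_]; rewrite -{1}(consttC p z) -!mulgA; congr (_ * _); exact: cHH.
    - by apply: cHH; rewrite ?groupM.
    - exact: pnat_coprime pza (p_elt_constt _ _).
  rewrite oz oza mulnA leq_mul2r; apply/orP; right.
  (* Otherwise [z.`_p * a] would lie in the cyclic group of [z.`_p], hence in Z. *)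
  have ndvd : ~~ (#[z.`_p * a] %| #[z.`_p]).
    apply/negP; rewrite !orderE (cardSg_cyclic cycH); last first.
    - by rewrite cycle_subG.
    - by rewrite cycle_subG groupM.
    move=> zaZ.
    case/negP: nZxp; rewrite -(groupMl a czp).
    have sub: <[z.`_p]> \subset Z by rewrite cycle_subG.
    by rewrite -cycle_subG (subset_trans zaZ).
  have oza_p := card_pgroup (pza : p.-group <[_]>).
  have oz_p := card_pgroup (p_elt_constt p z : p.-group <[_]>).
  rewrite -!orderE in oza_p oz_p; move: ndvd; rewrite oz_p oza_p.
  set i := logn _ _; set j := logn _ _.
  case: (leqP i j) => [/(dvdn_exp2l p)-> // | lt_ji _].
  (* For [p] not prime the [logn p] of any number is 0. *)
  have [pr_p | npr] := boolP (prime p).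
    apply: (@leq_trans (p ^ j.+1)); last by rewrite leq_exp2l ?prime_gt1.
    by rewrite expnS leq_mul2r prime_gt1 ?orbT.
  by move: lt_ji; rewrite /i lognE (negPf npr).
have sub : Z :* a \subset H :\: Z.
  apply/subsetP=> _ /rcosetP[z Zz ->]; rewrite inE groupMl // nZxp groupM //.
  exact: (subsetP sZH).
rewrite (psi_setD sZH) mulSn leq_add2l.
rewrite (big_setID (Z :* a)) /= (setIidPr sub) -[X in (X <= _)%N]addn0 leq_add //.
rewrite -rcosetE /rcoset big_imset; last exact: in2W (mulIg a).
by rewrite /psi big_distrr; apply: leq_sum.
Qed.

(** * Products of a Klein four-group and a cyclic group of odd order *)

Definition klein_times_cyclic (gT : finGroupType) (G : {group gT}) : Prop :=
  exists V K : {group gT},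
    [/\ V \x K = G, 2.-abelem V, #|V| = 4, cyclic K & odd #|K|].

Lemma psi_abelem4 (gT : finGroupType) (V : {group gT}) :
  2.-abelem V -> #|V| = 4 -> psi V = 7.
Proof.
move=> abV oV; rewrite (psi_setD (sub1G V)) /psi big_set1 order1.
rewrite (eq_bigr (fun=> 2)) => [|x /setD1P[nt_x Vx]].
  by rewrite sum_nat_const cardsD (setIidPr (sub1G V)) oV cards1.
exact: abelem_order_p abV Vx nt_x.
Qed.

Lemma psi_klein_times_cyclic (gT : finGroupType) (G : {group gT}) :
  klein_times_cyclic G -> (11 * psi G = 7 * psi (C #|G|))%N.
Proof.
case=> V [K [defG abV oV cycK oddK]].
have co4 : coprime 4 #|K| by rewrite (@coprime_pexpl 2 2) ?coprime2n.
have psi4 : (3 * psi (C 4) = 33)%N.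
  have oC : #|C 4| = 4 by exact: card_C.
  by rewrite (psi_cyclic_pgroup _ _ (cyclic_C 4)) /pgroup ?oC.
rewrite (psi_dprod defG) ?oV // -(dprod_card defG) oV psi_C_mul //.
have {}psi4 : psi (C 4) = 11 by move: psi4; lia.
by rewrite (psi_abelem4 abV oV) (psi_cyclic cycK) psi4 mulnCA.
Qed.

(** * Large element-order sums force elements of large order *)

Lemma exists_max_order (gT : finGroupType) (G : {group gT}) :
  exists2 x, x \in G & {in G, forall y, #[y] <= #[x]}.
Proof.
by case: (@arg_maxnP _ 1%g [in G] (fun x => #[x]) (group1 G)) => x Gx maxx; exists x.
Qed.

Lemma sum_order_le (gT : finGroupType) (A : {set gT}) m :
  {in A, forall y, #[y] <= m} -> (\sum_(y in A) #[y] <= #|A| * m)%N.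
Proof. by move=> le_m; rewrite -sum_nat_const; apply: leq_sum. Qed.

(** Half of the elements lie in the subgroup of index 2, where orders are at most
    half of [#|A|]. *)
Lemma psi_even_cyclic_upper_bound (gT : finGroupType) (A : {group gT}) :
  cyclic A -> ~~ odd #|A| -> (4 * psi A <= 3 * #|A| ^ 2)%N.
Proof.
case/cyclicP=> x defA evA; pose k := #|A|./2.
have oA : #|A| = (k * 2)%N by rewrite muln2 even_halfK.
have ox : #[x] = (k * 2)%N by rewrite -oA defA.
have oB : #|<[x ^+ 2]>| = k by rewrite -orderE orderXdiv ox ?dvdn_mull // mulnK.
have sBA : <[x ^+ 2]> \subset A by rewrite defA cycle_subG mem_cycle.
have leB : (psi <[x ^+ 2]> <= k * k)%N.
  rewrite -{1}oB; apply: sum_order_le => y By.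
  by rewrite -oB dvdn_leq ?cardG_gt0 ?order_dvdG.
have leD : (\sum_(y in A :\: <[x ^+ 2]>) #[y] <= k * (k * 2))%N.
  have oD : #|A :\: <[x ^+ 2]>| = k.
    by rewrite cardsD (setIidPr sBA) oB oA muln2 -addnn addnK.
  rewrite -oA -{1}oD; apply: sum_order_le => y /setDP[Ay _].
  by rewrite dvdn_leq ?cardG_gt0 ?order_dvdG.
rewrite (psi_setD sBA) oA.
by move: (psi _) (\sum_(y in _) _)%N leB leD => b d; nia.
Qed.

Lemma psi_le_max_order (gT : finGroupType) (G : {group gT}) x :
  x \in G -> {in G, forall y, #[y] <= #[x]} ->
  (psi G <= psi <[x]> + (#|G| - #[x]) * #[x])%N.
Proof.
move=> Gx maxx; have sxG : <[x]> \subset G by rewrite cycle_subG.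
rewrite (psi_setD sxG) leq_add2l orderE.
have <- : #|G :\: <[x]>| = (#|G| - #|<[x]>|)%N by rewrite cardsD (setIidPr sxG).
by rewrite -orderE; apply: sum_order_le => y /setDP[Gy _]; exact: maxx.
Qed.

(** A cyclic subgroup of largest order m has index 2 when G is not cyclic, for
    otherwise |G| >= 4 m makes psi(G) too small.  The elements outside it have order at most m, so
    3 psi(G) <= 5 m^2 + 1, while 3 psi(C_(2m)) = 8 m^2 + 1; this leaves m <= 2. *)
Lemma two_group_psi_large (gT : finGroupType) (G : {group gT}) :
  2.-group G -> (7 * psi (C #|G|) <= 11 * psi G)%N ->
  cyclic G \/ klein_times_cyclic G.
Proof.
move=> pG large.
case: (boolP (cyclic G)) => [|ncG]; [by left | right].
have [x Gx maxx] := exists_max_order G.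
have sxG : <[x]> \subset G by rewrite cycle_subG.
have ox := card_pgroup (pgroupS sxG pG); have oG := card_pgroup pG.
rewrite -orderE in ox.
have lt_xG : (#[x] < #|G|)%N.
  rewrite orderE ltn_neqAle subset_leq_card // andbT.
  apply: contraNneq ncG => eq_card; apply/cyclicP; exists x.
  by apply/eqP; rewrite eq_sym eqEcard sxG eq_card leqnn.
have psi_n : (3 * psi (C #|G|) = 2 * #|G| ^ 2 + 1)%N.
  have oC := card_C (cardG_gt0 G).
  by rewrite (psi_cyclic_pgroup _ _ (cyclic_C _)) /pgroup ?oC.
have psi_x : (3 * psi <[x]> = 2 * #[x] ^ 2 + 1)%N.
  exact: psi_cyclic_pgroup (pgroupS sxG pG) (cycle_cyclic x).
have psiG_x := psi_le_max_order Gx maxx.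
have psiG : (psi G <= #|G| * #[x])%N by exact: sum_order_le.
have {ox oG} [oG | le4] : #|G| = (2 * #[x])%N \/ (4 * #[x] <= #|G|)%N.
  move: lt_xG; rewrite oG ox.
  move: (logn 2 #|G|) (logn 2 #[x]) => a b; rewrite ltn_exp2l // leq_eqVlt.
  case/orP=> [/eqP <- | lt_xG]; [left | right]; first by rewrite expnS.
  by rewrite -(expnD 2 2) leq_exp2l.
- have o4 : #|G| = 4.
    have : (#[x] <= 2)%N.
      move: large psi_n psi_x psiG_x; rewrite oG.
      move: (psi _) (psi _) (psi _) => a b c; move: #[x] => d; nia.
    have : (3 < #|G|)%N by rewrite ltnNge; apply: contra ncG; exact: cyclic_small.
    lia.
  exists G, 1%G; rewrite dprodg1 o4 cards1 cyclic1; split=> //.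
  apply: exponent2_abelem; apply/exponentP=> y Gy.
  apply/eqP; rewrite -order_dvdn.
  have : #[y] %| 2 ^ 2 by rewrite -[(2 ^ 2)%N]/4 -o4 order_dvdG.
  case/dvdn_pfactor=> // k; rewrite leq_eqVlt => /orP[/eqP -> oy | lt_k ->].
    case/negP: ncG; apply/cyclicP; exists y; apply/eqP.
    by rewrite eq_sym eqEcard cycle_subG Gy -orderE oy o4.
  by rewrite (@dvdn_exp2l 2 k 1).
have := cardG_gt0 G; move: large psi_n psiG le4.
by move: (psi _) (psi _) => a b; move: #[x] #|G| => c d; nia.
Qed.

(** Comparing n o(x) >= psi(G) with the lower bound for psi(n) gives
    14 n <= 11 (q+1) o(x), which suffices when q > 3.  For q = 3 and n odd, the
    better constant of the odd case suffices.  For q = 3 and n even, index at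
    least 4 is excluded by the same comparison, but index 3 has to be excluded by
    counting: half of the elements of the cyclic subgroup of index 3 have order at
    most n/6, whence psi(G) <= 11/36 n^2 < 7/22 n^2. *)
Lemma psi_large_small_index (gT : finGroupType) (G : {group gT}) :
  (2 < max_pdiv #|G|)%N -> (7 * psi (C #|G|) <= 11 * psi G)%N ->
  exists2 x, x \in G & (#|G : <[x]>| < max_pdiv #|G|)%N.
Proof.
set q := max_pdiv _ => q_gt2 large.
have [x Gx maxx] := exists_max_order G; exists x => //.
have sxG : <[x]> \subset G by rewrite cycle_subG.
have oG := Lagrange sxG; rewrite -orderE in oG.
have psiG : (psi G <= #|G| * #[x])%N by exact: sum_order_le.
have psiG_x := psi_le_max_order Gx maxx.
have G_gt0 := cardG_gt0 G; have x_gt0 := order_gt0 x.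
have pi_le p : p \in \pi(#|G|) -> (1 < p <= q)%N.
  move=> pi_p; rewrite max_pdiv_max // andbT prime_gt1 //.
  by move: pi_p; rewrite mem_primes => /andP[].
rewrite -(ltn_pmul2l x_gt0) oG.
have lower := psi_C_lower_bound (ltnW (ltnW q_gt2)) G_gt0 pi_le.
have [q_gt3 | q_le3] := ltnP 3 q.
  move: large lower psiG.
  move: (psi _) (psi _) => a b large lower psiG.
  have : (14 * #|G| <= 11 * q.+1 * #[x])%N.
    rewrite -(leq_pmul2l G_gt0); nia.
  nia.
have q3 : q = 3 by lia.
have [oddG | evenG] := boolP (odd #|G|).
  have pi_gt2 p : p \in \pi(#|G|) -> (2 < p <= q)%N.
    move=> pi_p; have /andP[p_gt1 ->] := pi_le p pi_p; rewrite andbT.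
    rewrite ltn_neqAle p_gt1 andbT; apply: contraTneq oddG => p2.
    by move: pi_p; rewrite -p2 mem_primes dvdn2 => /and3P[].
  have {}lower := psi_C_lower_bound (ltnW q_gt2) G_gt0 pi_gt2.
  rewrite q3 in lower *.
  move: large lower psiG; move: (psi _) (psi _) => a b.
  by move: #|G| #[x] G_gt0 => c d; nia.
rewrite q3 ltnNge in lower *; apply/negP=> le3.
have [lt3 | eq3] : (4 * #[x] <= #|G|)%N \/ #|G| = (3 * #[x])%N.
  move: le3; rewrite -oG ![(_ * #[x])%N]mulnC !leq_pmul2l //.
  rewrite leq_eqVlt => /orP[/eqP -> | lt3]; last by left.
  by right; rewrite mulnC.
- move: large lower psiG lt3; move: (psi _) (psi _) => a b.
  by move: #|G| #[x] G_gt0 => c d; nia.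
have even_x : ~~ odd #|<[x]>| by move: evenG; rewrite eq3 oddM.
have := psi_even_cyclic_upper_bound (cycle_cyclic x) even_x; rewrite -orderE.
move: large lower psiG_x; rewrite eq3.
move: (psi _) (psi _) (psi _) => a b c; move: #[x] x_gt0 => d; nia.
Qed.

(** * A normal cyclic Sylow subgroup *)

Lemma small_index_normal_Sylow (gT : finGroupType) (G : {group gT}) q x :
  prime q -> x \in G -> (#|G : <[x]>| < q)%N ->
  exists P : {group gT}, [/\ q.-Sylow(G) P, P <| G & cyclic P].
Proof.
move=> pr_q Gx lt_q; have sxG : <[x]> \subset G by rewrite cycle_subG.
have [P sylP] := Sylow_exists q <[x]>; exists P.
have sPx := pHall_sub sylP; have sPG := subset_trans sPx sxG.
have sylPG : q.-Sylow(G) P.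
  rewrite pHallE sPG (card_Hall sylP) -(Lagrange sxG) partnM ?cardG_gt0 //=.
  rewrite [X in _ == (_ * X)%N]part_p'nat ?muln1 // p'natE //.
  by apply: contraL lt_q => /dvdn_leq; rewrite -leqNgt => ->.
split=> //; last exact: cyclicS sPx (cycle_cyclic x).
have sxN : <[x]> \subset 'N_G(P).
  by rewrite subsetI sxG sub_abelian_norm ?cycle_abelian.
have := card_Syl_mod G pr_q; rewrite (card_Syl sylPG).
rewrite modn_small; last by apply: leq_ltn_trans lt_q; rewrite dvdn_leq ?indexgS.
move/eqP; rewrite indexg_eq1 subsetI => /andP[_ nPG].
by rewrite /normal sPG.
Qed.

(** With |P| / psi(P) <= 3/7 and psi(Z) / psi(H) <= 1/3 in [psi_sdprod], the ratio
    psi(G) / (psi(P) psi(H)) is at most 3/7 + (1 - 3/7) / 3 = 13/21 < 7/11.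
    The symmetric group of degree 3 attains 13/21. *)
Lemma psi_sdprod_cyclic_lt (gT : finGroupType) (G P H : {group gT}) (q : nat) :
  P ><| H = G -> q.-group P -> (2 < q)%N -> cyclic P -> P :!=: 1 ->
  coprime #|P| #|H| -> cyclic H -> ~~ (H \subset 'C(P)) ->
  (11 * psi G < 7 * (psi P * psi H))%N.
Proof.
move=> defG qP q_gt2 cycP ntP coPH cycH ncPH.
have psiG := psi_sdprod defG qP cycP coPH.
have psiP := psi_pgroup_lower_bound qP q_gt2 ntP.
have psiZ : (3 * psi 'C_H(P) <= psi H)%N.
  by apply: psi_proper_cyclic_le; rewrite // properE subsetIl subsetI subxx.
have psiH_gt0 : (0 < psi H)%N by apply: leq_trans (cardG_le_psi H).
have leP := cardG_le_psi P; have := cardG_gt0 P.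
move: psiG psiP psiZ psiH_gt0 leP.
move: (psi G) (psi P) (psi 'C_H(P)) (psi H) #|P| => g p z h n.
move=> psiG psiP psiZ h_gt0 leP n_gt0.
have e1 : (3 * g <= (2 * n + p) * h)%N.
  have : ((p - n) * (3 * z) <= (p - n) * h)%N by rewrite leq_mul2l psiZ orbT.
  rewrite !mulnBl; nia.
have e2 : (7 * (2 * n + p) * h <= 13 * p * h)%N by rewrite leq_mul2r; lia.
have ph_gt0 : (0 < p * h)%N by rewrite muln_gt0 h_gt0 (leq_trans n_gt0).
move: e1 e2; rewrite -!mulnA; nia.
Qed.

(** * The classification *)

Lemma psi_large_cyclic_or_klein (gT : finGroupType) (G : {group gT}) :
  (7 * psi (C #|G|) <= 11 * psi G)%N -> cyclic G \/ klein_times_cyclic G.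
Proof.
have [m] := ubnP #|G|; elim: m G => // m IHm G /ltnSE-leGm large.
have [le1 | G_gt1] := leqP #|G| 1.
  by left; apply: cyclic_small; apply: leq_trans le1 _.
have pr_q := max_pdiv_prime G_gt1; set q := max_pdiv _ in pr_q.
have [q_le2 | q_gt2] := leqP q 2.
  apply: two_group_psi_large => //.
  apply/pgroupP=> p pr_p p_dvd; rewrite inE /= eqn_leq prime_gt1 // andbT.
  apply: leq_trans q_le2; apply: max_pdiv_max.
  by rewrite mem_primes pr_p cardG_gt0.
have [x Gx lt_q] := psi_large_small_index q_gt2 large.
have [P [sylP nPG cycP]] := small_index_normal_Sylow pr_q Gx lt_q.
have [sPG qP _] := and3P sylP.
have /splitsP[H complH] := SchurZassenhaus_split (pHall_Hall sylP) nPG.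
have defG : P ><| H = G by apply/sdprod_normal_complP; rewrite // complgC.
have oG := sdprod_card defG.
have coPH : coprime #|P| #|H|.
  by rewrite (coprime_sdprod_Hall_l defG) (pHall_Hall sylP).
have ntP : P :!=: 1.
  rewrite -cardG_gt1 (card_Hall sylP) p_part_gt1 mem_primes pr_q cardG_gt0.
  exact: max_pdiv_dvd.
have ltHm : (#|H| < m)%N.
  apply: leq_trans leGm; rewrite -oG ltn_Pmull ?cardG_gt0 //.
  by rewrite cardG_gt1.
have psiPH : psi (C #|G|) = (psi P * psi (C #|H|))%N.
  by rewrite -oG psi_C_mul ?cardG_gt0 // (psi_cyclic cycP).
have P_gt0 : (0 < psi P)%N by apply: leq_trans (cardG_gt0 P) (cardG_le_psi P).
have [cPH | ncPH] := boolP (H \subset 'C(P)).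
  have dG : P \x H = G by rewrite dprodEsd.
  have largeH : (7 * psi (C #|H|) <= 11 * psi H)%N.
    rewrite -(leq_pmul2l P_gt0) !(mulnCA (psi P)).
    by rewrite -psiPH -(psi_dprod dG coPH).
  case: (IHm H ltHm largeH) => [cycH | [V [K [defH abV oV cycK oddK]]]].
    by left; rewrite (cyclic_dprod dG).
  have dG' : V \x (K \x P) = G by rewrite dprodA defH dprodC.
  have [[_ PK _ dPK] _ _ _] := dprodP dG'.
  have coKP : coprime #|K| #|P|.
    by rewrite coprime_sym (coprime_dvdr _ coPH) // -(dprod_card defH) dvdn_mull.
  right; exists V, PK.
  split=> //; [by rewrite -dPK | by rewrite (cyclic_dprod dPK) |].
  rewrite -(dprod_card dPK) oddM oddK /=; apply: odd_pgroup_odd qP.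
  by case: (even_prime pr_q) q_gt2 => [->|].
have ltG := psi_sdprod_lt defG qP cycP coPH ntP ncPH.
have ltH : (7 * psi (C #|H|) < 11 * psi H)%N.
  rewrite -(ltn_pmul2l P_gt0) !(mulnCA (psi P)) -psiPH.
  by apply: leq_ltn_trans large _; rewrite ltn_pmul2l.
case: (IHm H ltHm (ltnW ltH)) => [cycH | kH].
  have := psi_sdprod_cyclic_lt defG qP q_gt2 cycP ntP coPH cycH ncPH.
  by rewrite (psi_cyclic cycH) -psiPH ltnNge large.
by move: ltH; rewrite (psi_klein_times_cyclic kH) ltnn.
Qed.

Lemma second_maximalE (gT : finGroupType) (G : {group gT}) :
  second_maximal G <-> (11 * psi G = 7 * psi (C #|G|))%N.
Proof.
rewrite /second_maximal; set a := psi G; set b := psi _.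
rewrite GRing.mulrAC; split=> eq_ab.
  have : (11%:R * a%:R = 7%:R * b%:R :> rat)%R.
    by rewrite eq_ab GRing.mulrC GRing.divfK.
  by rewrite -!GRing.natrM => /eqP; rewrite Num.Theory.eqr_nat => /eqP.
by rewrite -GRing.natrM -eq_ab GRing.natrM GRing.mulrC GRing.mulKf.
Qed.

Lemma abelem_C2xC2 : 2.-abelem (setX (C 2) (C 2)) /\ #|setX (C 2) (C 2)| = 4.
Proof.
split; last by rewrite cardsX !card_C.
have abC2 : 2.-abelem (C 2) by rewrite prime_abelem ?card_C.
rewrite (dprod_abelem 2 (setX_dprod (C 2) (C 2))).
by rewrite -(isog_abelem (isog_setX1 _ _)) -(isog_abelem (isog_set1X _ _)) !abC2.
Qed.

Theorem theorem2 (gT : finGroupType) (G : {group gT}) (n : nat) (hn : #|G| = n) :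
  second_maximal G <->
  exists k : nat,
    [/\ (0 < k)%N, n = (4 * k)%N, coprime k 2
      & G \isog setX (setX (C 2) (C 2)) (C k)].
Proof.
rewrite second_maximalE; have [abX oX] := abelem_C2xC2.
split=> [eqG | [k [k_gt0 def_n co_k2 isoG]]].
  have [cycG | [V [K [defG abV oV cycK oddK]]]] : cyclic G \/ klein_times_cyclic G.
  - by apply: psi_large_cyclic_or_klein; rewrite eqG.
  - by move: eqG (psi_C_gt0 #|G|); rewrite (psi_cyclic cycG); lia.
  exists #|K|; rewrite cardG_gt0 coprime_sym coprime2n -hn -(dprod_card defG) oV.
  split=> //; apply: isog_dprod defG (setX_dprod _ _) _ _.
    apply: isog_trans (isog_setX1 _ _).
    by rewrite (isog_abelem_card _ abV) abX oX oV.
  apply: isog_trans (isog_set1X _ _).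
  by rewrite isog_cyclic_card // cyclic_C card_C ?cardG_gt0 /=.
have -> : psi G = psi (setX (setX (C 2) (C 2)) (C k)) by exact: psi_isog.
rewrite (card_isog isoG); apply: psi_klein_times_cyclic.
have i1 := isog_setX1 [the finGroupType of 'Z_k] (setX (C 2) (C 2)).
have i2 := isog_set1X [the finGroupType of ('Z_2 * 'Z_2)%type] (C k).
exists (setX (setX (C 2) (C 2)) 1), (setX 1 (C k)).
rewrite setX_dprod -(isog_abelem i1) -(card_isog i1) -(isog_cyclic i2) -(card_isog i2).
by rewrite cyclic_C card_C // -coprime2n coprime_sym.
Qed.
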